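(* Let $\mathrm L$ be a spline-admissible operator that is compatible with $\mathcal X'$ (see context). Then, for any two biorthogonal systems $(\boldsymbol\phi,\boldsymbol p)$ and $(\tilde{\boldsymbol\phi},\tilde{\boldsymbol p})$ with $\mathcal N_{\boldsymbol p}=\mathcal N_{\tilde{\boldsymbol p}}=\mathcal N_{\mathrm L}$ and $\boldsymbol\phi,\tilde{\boldsymbol\phi}\in\mathcal X_{\mathrm L}^{N_0}$, with associated pre-dual/native pairs $(\mathcal X_{\mathrm L},\mathcal X'_{\mathrm L})$ and $(\tilde{\mathcal X}_{\mathrm L},\tilde{\mathcal X}'_{\mathrm L})$, we have that: - $\mathcal X_{\mathrm L}=\tilde{\mathcal X}_{\mathrm L}$ and $\mathcal X'_{\mathrm L}=\tilde{\mathcal X}'_{\mathrm L}$ as sets; - the norms $\|\cdot\|_{\mathcal X_{\mathrm L}}$ and $\|\cdot\|_{\tilde{\mathcal X}_{\mathrm L}}$ are equivalent on $\mathcal X_{\mathrm L}$; - the norms $\|\cdot\|_{\mathcal X'_{\mathrm L}}$ and $\|\cdot\|_{\tilde{\mathcal X}'_{\mathrm L}}$ are equivalent on $\mathcal X'_{\mathrm L}$. More precisely, with $$\|f\|_{\tilde{\mathcal X}'_{\mathrm L}}=\|\mathrm Lf\|_{\mathcal X'}+\|\tilde{\boldsymbol\phi}(f)\|_2,\qquad \|g\|_{\tilde{\mathcal X}_{\mathrm L}}=\|\mathrm L_{\tilde{\boldsymbol\phi}}^{-1\ast}g\|_{\mathcal X}+\|\tilde{\boldsymbol p}(g)\|_2,$$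 there are constants $A_1,A_2,B_1,B_2,A_1',A_2',B_1',B_2'>0$ such that $$\forall f\in\mathcal X'_{\mathrm L}:\ \|\mathrm Lf\|_{\mathcal X'}=\|(\mathrm{Id}-\mathrm{Proj}_{\mathcal N_{\tilde{\boldsymbol p}}})\{f\}\|_{\tilde{\mathcal X}'_{\mathrm L}},$$ $$\forall f\in\mathcal X'_{\mathrm L}:\ A_1\|f\|_{\mathcal X'_{\mathrm L}}\le\|f\|_{\tilde{\mathcal X}'_{\mathrm L}}\le A_2\|f\|_{\mathcal X'_{\mathrm L}},$$ $$\forall p\in\mathcal N_{\mathrm L}=\mathcal N_{\boldsymbol p}:\ B_1\|\boldsymbol\phi(p)\|_2\le\|\tilde{\boldsymbol\phi}(p)\|_2\le B_2\|\boldsymbol\phi(p)\|_2,$$ $$\forall u\in\mathcal U=\mathrm L^\ast(\mathcal X):\ \|\mathrm L_{\tilde{\boldsymbol\phi}}^{-1\ast}u\|_{\mathcal X}=\|(\mathrm{Id}-\mathrm{Proj}_{\mathcal N_{\tilde{\boldsymbol\phi}}})\{u\}\|_{\mathcal X_{\mathrm L}}=\|\mathrm L^{-1\ast}u\|_{\mathcal X},$$ $$\forall g\in\mathcal X_{\mathrm L}:\ A_1'\|g\|_{\mathcal X_{\mathrm L}}\le\|g\|_{\tilde{\mathcal X}_{\mathrm L}}\le A_2'\|g\|_{\mathcal X_{\mathrm L}},$$ $$\forall g\in\mathcal X_{\mathrm L}:\ B_1'\|\boldsymbol p(g)\|_2\le\|\tilde{\boldsymbol p}(g)\|_2\le B_2'\|\boldsymbol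 p(g)\|_2.$$
   Context: All functions and spaces are real. $\mathcal S(\mathbb R^d)$ is the Schwartz space, $\mathcal S'(\mathbb R^d)$ the space of tempered distributions, $\langle\cdot,\cdot\rangle$ the duality product. Schwartz-Banach space: a normed space $(\mathcal X,\|\cdot\|_{\mathcal X})\subseteq\mathcal S'(\mathbb R^d)$ that is a Banach space with $\mathcal S(\mathbb R^d)\subseteq\mathcal X\subseteq\mathcal S'(\mathbb R^d)$, both inclusions being continuous with dense range (equivalently, $\mathcal X$ is the completion of $\mathcal S(\mathbb R^d)$ in the norm $\|\cdot\|_{\mathcal X}$). Its dual $\mathcal X'$ is viewed as a subspace of $\mathcal S'(\mathbb R^d)$ by restricting functionals to $\mathcal S(\mathbb R^d)$. Weighted spaces: for $\alpha\in\mathbb R$, $L_{\infty,\alpha}(\mathbb R^d)$ is the space of measurable $f$ with $\|f\|_{\infty,\alpha}=\operatorname{ess\,sup}_x(1+\|x\|)^{-\alpha}|f(x)|<\infty$; it is the dual of $L_{1,-\alpha}(\mathbb R^d)$, which has norm $\|g\|_{1,-\alpha}=\int_{\mathbb R^d}(1+\|x\|)^{\alpha}|g(x)|\,dx$. Spline-admissible operator: a linear operator $\mathrm L:\mathcal S(\mathbb R^d)\to\mathcal S'(\mathbb R^d)$ is spline-admissible with order $\alpha\in\mathbb R$ if there exist an operator $\mathrm L^{-1}$ and a finite-dimensional space $\mathcal N_{\boldsymbol p}=\mathrm{span}\{p_n\}_{n=1}^{N_0}$ (dimension $N_0$) such that: (1) $\mathrm L$ and its adjoint $\mathrm L^\ast$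 map $\mathcal S(\mathbb R^d)\to L_{1,-\alpha}(\mathbb R^d)$ continuously; (2) $\mathrm L^{-1}$ and its adjoint $\mathrm L^{-1\ast}$ map $L_{1,-\alpha}(\mathbb R^d)\to L_{\infty,\alpha}(\mathbb R^d)$ continuously; (3) $\mathrm L^{-1\ast}\mathrm L^\ast\varphi=\varphi$ and $\mathrm L^{-1}\mathrm L\varphi=\varphi$ for all $\varphi\in\mathcal S(\mathbb R^d)$; (4) $\mathcal N_{\boldsymbol p}=\mathcal N_{\mathrm L}:=\{p\in L_{\infty,\alpha}(\mathbb R^d):\mathrm L\{p\}=0\}$, where $\mathrm L$ is extended to $L_{\infty,\alpha}(\mathbb R^d)\to\mathcal S'(\mathbb R^d)$ by $\langle\mathrm Lf,\varphi\rangle=\langle f,\mathrm L^\ast\varphi\rangle$, $\varphi\in\mathcal S(\mathbb R^d)$. Compatibility: $\mathrm L$ is compatible with $\mathcal X'$ if (1) $\mathcal X$ is a Schwartz-Banach space; (2) $\mathrm L$ is spline-admissible with order $\alpha$; (3) $\mathrm L^\ast$ is (extends to) a continuous and injective operator $\mathcal X\to\mathcal S'(\mathbb R^d)$; (4) ($\mathcal X$-stability) there is a universal biorthogonal system $(\boldsymbol\phi^0,\boldsymbol p^0)$ of $\mathcal N_{\mathrm L}$, i.e. $\boldsymbol p^0$ is a basis of $\mathcal N_{\mathrm L}$, $\boldsymbol\phi^0\in\mathcal S(\mathbb R^d)^{N_0}$, $\langle\phi^0_m,p^0_n\rangle=\delta_{m,n}$, such that $\mathrm L_{\boldsymbol\phi^0}^{-1\ast}:=\mathrm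 L^{-1\ast}(\mathrm{Id}-\mathrm{Proj}_{\mathcal N_{\boldsymbol\phi^0}})$ maps $L_{1,-\alpha}(\mathbb R^d)\to\mathcal X$ continuously, where $\mathrm{Proj}_{\mathcal N_{\boldsymbol\phi^0}}\{g\}=\sum_n\langle p^0_n,g\rangle\phi^0_n$. Reference spaces: $\mathcal U=\mathrm L^\ast(\mathcal X)$ with norm $\|\mathrm L^\ast v\|_{\mathcal U}=\|v\|_{\mathcal X}$; $\mathrm L^{-1\ast}:\mathcal U\to\mathcal X$ denotes the isometric inverse of $\mathrm L^\ast:\mathcal X\to\mathcal U$ (the continuous extension of $\mathrm L^{-1\ast}$ from $\mathrm L^\ast(\mathcal S(\mathbb R^d))$). The completion of $\mathrm L^\ast(\mathcal S(\mathbb R^d))\oplus\mathcal N_{\boldsymbol\phi^0}$ in the norm $\max(\|\mathrm L_{\boldsymbol\phi^0}^{-1\ast}g\|_{\mathcal X},\|\boldsymbol p^0(g)\|_2)$ is the Schwartz-Banach space $\mathcal U\oplus\mathcal N_{\boldsymbol\phi^0}$. This is the pre-dual space $\mathcal X_{\mathrm L}$ to which $\phi_n,\tilde\phi_n$ are required to belong; elements of $\mathcal N_{\mathrm L}$ act on it as continuous functionals vanishing on $\mathcal U$. For a general system: a biorthogonal system $(\boldsymbol\phi,\boldsymbol p)$ consists of a basis $\boldsymbol p$ of $\mathcal N_{\mathrm L}$ and $\phi_1,\dots,\phi_{N_0}$ in that pre-dual space with $\langle\phi_m,p_n\rangle=\delta_{m,n}$. Put $\mathcal N_{\boldsymbol\phi}=\mathrm{span}\{\phi_n\}$,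 $\boldsymbol p(g)=(\langle p_n,g\rangle)_n$, $\boldsymbol\phi(f)=(\langle\phi_n,f\rangle)_n$, $\mathrm{Proj}_{\mathcal N_{\boldsymbol\phi}}\{g\}=\sum_n\langle p_n,g\rangle\phi_n$, $\mathrm{Proj}_{\mathcal N_{\boldsymbol p}}\{f\}=\sum_n\langle\phi_n,f\rangle p_n$, $\mathrm L_{\boldsymbol\phi}^{-1\ast}=\mathrm L^{-1\ast}(\mathrm{Id}-\mathrm{Proj}_{\mathcal N_{\boldsymbol\phi}})$. Its pre-dual space is $\mathcal X_{\mathrm L}=\mathcal U\oplus\mathcal N_{\boldsymbol\phi}$ with norm $\|g\|_{\mathcal X_{\mathrm L}}=\max(\|\mathrm L_{\boldsymbol\phi}^{-1\ast}g\|_{\mathcal X},\|\boldsymbol p(g)\|_2)$. Its native space is the dual $\mathcal X'_{\mathrm L}=\{\mathrm L_{\boldsymbol\phi}^{-1}w+p:w\in\mathcal X',p\in\mathcal N_{\mathrm L}\}$ with $\|f\|_{\mathcal X'_{\mathrm L}}=\|\mathrm Lf\|_{\mathcal X'}+\|\boldsymbol\phi(f)\|_2$, where $\mathrm L_{\boldsymbol\phi}^{-1}$ is the adjoint of $\mathrm L_{\boldsymbol\phi}^{-1\ast}:\mathcal X_{\mathrm L}\to\mathcal X$ and $\mathrm L:\mathcal X'_{\mathrm L}\to\mathcal X'$ is the adjoint of $\mathrm L^\ast:\mathcal X\to\mathcal X_{\mathrm L}$. The objects with tildes are those attached to $(\tilde{\boldsymbol\phi},\tilde{\boldsymbol p})$: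 in particular $\tilde{\mathcal X}_{\mathrm L}=\mathcal U\oplus\mathcal N_{\tilde{\boldsymbol\phi}}$.
   Formalization: The formal theorem assumes explicitly that the sum of U = L*(X) and the span of φ⁰ is direct; the context asserts this, but it does not follow from the listed compatibility conditions, and without it N_L cannot act on the pre-dual by functionals vanishing on U. *)

(* Defs.v *)
From HB Require Import structures.
From mathcomp Require Import all_boot all_order all_algebra.
From mathcomp Require Import all_classical all_reals all_analysis.
From mathcomp Require Import ring.

Set Implicit Arguments.
Unset Strict Implicit.
Unset Printing Implicit Defensive.

Import Order.TTheory GRing.Theory Num.Theory.
Import numFieldNormedType.Exports.

Local Open Scope classical_set_scope.
Local Open Scope ring_scope.

Definition rV_display : measure_display.
Proof. exact: default_measure_display. Qed.

(* The sigma-algebra generated by the coordinates, i.e. the Borel one. *)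
Section measurable_rV.
Variables (R : realType) (d : nat).

Let coors : 'I_d -> 'rV[R]_d -> measurableTypeR R := fun i x => x ord0 i.

Let rV_set0 : g_sigma_preimage coors set0.
Proof. exact: sigma_algebra0. Qed.

Let rV_setC A : g_sigma_preimage coors A -> g_sigma_preimage coors (~` A).
Proof. exact: sigma_algebraC. Qed.

Let rV_bigcup (F : _^nat) : (forall i, g_sigma_preimage coors (F i)) ->
  g_sigma_preimage coors (\bigcup_i (F i)).
Proof. exact: sigma_algebra_bigcup. Qed.

HB.instance Definition _ := @isMeasurable.Build rV_display 'rV[R]_d
  (g_sigma_preimage coors) rV_set0 rV_setC rV_bigcup.

Lemma measurable_to_rV d1 (T : measurableType d1) (f : T -> 'rV[R]_d) :
  (forall i, measurable_fun setT (fun t => f t ord0 i : measurableTypeR R)) ->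
  measurable_fun setT f.
Proof.
move=> mf _ A mA; rewrite setTI.
pose G := [set B : set 'rV[R]_d | measurable (f @^-1` B)].
suff : (measurable : set_system 'rV[R]_d) `<=` G by exact.
apply: smallest_sub.
  split => [|B GB|F GF]; rewrite /G /=.
  - by rewrite preimage_set0.
  - by rewrite setTD -preimage_setC; exact: measurableC.
  - by rewrite preimage_bigcup; exact: bigcupT_measurable.
move=> B; rewrite -bigcup_seq => -[i /= _ [C mC <-]]; rewrite /G /=.
rewrite setTI -comp_preimage -[X in measurable X]setTI.
exact: mf.
Qed.

End measurable_rV.

Section lebesgue_rV.
Variable R : realType.

Definition cons_rV n (x : measurableTypeR R * 'rV[R]_n) : 'rV[R]_n.+1 :=
  row_mx (x.1%:M : 'rV_1) x.2.

Lemma measurable_cons_rV n : measurable_fun setT (@cons_rV n).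
Proof.
apply: (@measurable_to_rV R (1 + n)) => i.
rewrite /cons_rV; case: (split_ordP i) => j ->.
  apply: (eq_measurable_fun fst) => // x _.
  by rewrite row_mxEl !ord1 mxE eqxx.
apply: (eq_measurable_fun
  ((fun v : 'rV[R]_n => v ord0 j : measurableTypeR R) \o snd)).
  by move=> x _; rewrite /= row_mxEr.
apply: measurableT_comp => //.
move=> _ Y mY; rewrite setTI; apply: sub_sigma_algebra => /=.
rewrite -bigcup_seq/=; exists j => /=; first by rewrite mem_index_enum.
by exists Y => //; rewrite setTI.
Qed.

Section prod_lebesgue.
Variables (n : nat) (mu : {measure set 'rV[R]_n -> \bar R}).

Definition prod_lebesgue : set 'rV[R]_n.+1 -> \bar R :=
  pushforward (@lebesgue_measure R \x^ mu)%E (@cons_rV n).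

Let prod_lebesgue0 : prod_lebesgue set0 = 0%E.
Proof. by rewrite /prod_lebesgue /pushforward preimage_set0 measure0. Qed.

Let prod_lebesgue_ge0 A : (0 <= prod_lebesgue A)%E.
Proof. by rewrite /prod_lebesgue /pushforward. Qed.

Let prod_lebesgue_sigma_additive : semi_sigma_additive prod_lebesgue.
Proof.
move=> F mF tF mUF; apply: measure_semi_sigma_additive => //.
exact: measurable_cons_rV.
Qed.

HB.instance Definition _ := isMeasure.Build _ _ _ prod_lebesgue
  prod_lebesgue0 prod_lebesgue_ge0 prod_lebesgue_sigma_additive.

End prod_lebesgue.

Fixpoint lebesgue_rV (n : nat) : {measure set 'rV[R]_n -> \bar R} :=
  match n with
  | 0 => \d_(0 : 'rV[R]_0)
  | m.+1 => prod_lebesgue (lebesgue_rV m)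
  end.

End lebesgue_rV.

Section schwartz.
Variables (R : realType) (d : nat).

Definition enorm n (x : 'rV[R]_n) : R := Num.sqrt (\sum_i x ord0 i ^+ 2).

Definition pderiv (s : seq 'I_d) (f : 'rV[R]_d -> R) : 'rV[R]_d -> R :=
  foldr (fun i g => 'D_(delta_mx ord0 i) g) f s.

Definition weighted_pderiv (k : nat) (s : seq 'I_d) (f : 'rV[R]_d -> R) :
  'rV[R]_d -> R := fun x => (1 + enorm x) ^+ k * pderiv s f x.

Definition is_schwartz : set ('rV[R]_d -> R) :=
  [set f | (forall s x, differentiable (pderiv s f) x) /\
           (forall k s, exists M, forall x, `|weighted_pderiv k s f x| <= M)].

Definition schwartz_pred : {pred 'rV[R]_d -> R} := mem is_schwartz.

Lemma pderivD a f g s : is_schwartz f -> is_schwartz g ->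
  pderiv s (a *: f + g) = a *: pderiv s f + pderiv s g.
Proof.
move=> [df _] [dg _]; elim: s => //= i s ->; apply/funext => x.
have Df := diff_derivable (v := delta_mx ord0 i) (df s x).
have Dg := diff_derivable (v := delta_mx ord0 i) (dg s x).
by rewrite deriveD ?deriveZ //; exact: derivableZ.
Qed.

Lemma pderiv0 s : pderiv s (0 : 'rV[R]_d -> R) = 0.
Proof.
elim: s => //= i s ->; apply/funext => x.
by rewrite -[0 in LHS]/(cst 0) derive_cst.
Qed.

Lemma schwartz_submod_closed : submod_closed schwartz_pred.
Proof.
split=> [|a f g].
  rewrite inE; split=> [s x|k s]; first by rewrite pderiv0; exact: differentiable_cst.
  by exists 0 => x; rewrite /weighted_pderiv pderiv0 mulr0 normr0.
rewrite !inE => fS gS; have [df bf] := fS; have [dg bg] := gS; split=> [s x|k s].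
  by rewrite pderivD //; apply: differentiableD => //; exact: differentiableZ.
have [M fM] := bf k s; have [N gN] := bg k s.
exists (`|a| * M + N) => x; rewrite /weighted_pderiv pderivD //.
rewrite mulrDr; apply: (le_trans (ler_normD _ _)); apply: lerD; last exact: gN.
by rewrite mulrCA normrM ler_wpM2l //; exact: fM.
Qed.

HB.instance Definition _ := GRing.isSubmodClosed.Build _ _ schwartz_pred
  schwartz_submod_closed.

Record schwartz := Schwartz {
  schwartz_fun :> 'rV[R]_d -> R ;
  _ : schwartz_fun \in schwartz_pred }.

HB.instance Definition _ := [isSub for schwartz_fun].
HB.instance Definition _ := [Choice of schwartz by <:].
HB.instance Definition _ := [SubChoice_isSubLmodule of schwartz by <:].

(* Uniform convergence of all (1 + |x|)^k D^s f: the Schwartz topology. *)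
HB.instance Definition _ := Topological.copy schwartz
  (initial_topology (fun (f : schwartz) =>
     (fun ks => weighted_pderiv ks.1 ks.2 f) :
       prod_topology (fun _ : nat * seq 'I_d => {uniform 'rV[R]_d -> R}))).

Definition is_tempered : set (schwartz -> R) :=
  [set T : schwartz -> R | scalar T /\ continuous T].

Definition tempered_pred : {pred schwartz -> R} := mem is_tempered.

Lemma tempered_submod_closed : submod_closed tempered_pred.
Proof.
split=> [|a T U].
  by rewrite inE; split=> [a f g|]; [rewrite /= mulr0 addr0|exact: cst_continuous].
rewrite !inE => -[lT cT] [lU cU]; split=> [b f g|f].
  by rewrite !fctE lT lU /GRing.scale /=; ring.
exact: (cvgD (cvgZl_tmp (k := a) (cT f)) (cU f)).
Qed.

HB.instance Definition _ := GRing.isSubmodClosed.Build _ _ tempered_pred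
  tempered_submod_closed.

Record tempered := Tempered {
  tempered_fun :> schwartz -> R ;
  _ : tempered_fun \in tempered_pred }.

HB.instance Definition _ := [isSub for tempered_fun].
HB.instance Definition _ := [Choice of tempered by <:].
HB.instance Definition _ := [SubChoice_isSubLmodule of tempered by <:].

(* The weak-* topology. *)
HB.instance Definition _ := Topological.copy tempered
  (initial_topology (fun T : tempered => (T : {ptws schwartz -> R}))).

End schwartz.

Section weighted_spaces.
Variables (R : realType) (d : nat).
Implicit Types (T : tempered R d) (p : \bar R) (alpha : R).

Let mu := lebesgue_rV R d.

Definition density_of T (f : 'rV[R]_d -> R) : Prop :=
  measurable_fun setT f /\
  forall phi : schwartz R d, mu.-integrable setT (fun x => (f x * phi x)%:E) /\
    T phi = \int[mu]_x (f x * phi x).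

(* Two densities of the same distribution agree almost everywhere, so norms
   and integrals of [density T] do not depend on the choice made here. *)
Definition density T : 'rV[R]_d -> R := xget (cst 0) [set f | density_of T f].

Definition ewLnorm p alpha T : \bar R :=
  'N[mu]_p[(fun x => ((1 + enorm x) `^ (- alpha) * density T x)%:E)].

Definition wLnorm p alpha T : R := fine (ewLnorm p alpha T).

(* L_{p,alpha}, as a subspace of the tempered distributions; its norm is
   ||(1 + |x|)^(-alpha) f||_p, so that L_{1,-alpha} carries the weight
   (1 + |x|)^alpha. *)
Definition wLspace p alpha : set (tempered R d) :=
  [set T | (exists f, density_of T f) /\ (ewLnorm p alpha T < +oo)%E].

Definition Lpair T U : R := \int[mu]_x (density T x * density U x).

End weighted_spaces.

Section normed_subspaces.
Variable R : realType.

Record continuous_operator (V W : lmodType R) (A : set V) (nA : V -> R)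
    (B : set W) (nB : W -> R) (F : V -> W) : Prop := ContinuousOperator {
  co_linear : forall a u v, A u -> A v -> F (a *: u + v) = a *: F u + F v ;
  co_maps : forall u, A u -> B (F u) ;
  co_continuous : forall u, A u -> forall e, 0 < e ->
    exists2 r, 0 < r & forall v, A v -> nA (v - u) < r -> nB (F v - F u) < e }.

Definition linspan (V : lmodType R) N (x : 'I_N -> V) : set V :=
  [set v | exists c : 'I_N -> R, v = \sum_n c n *: x n].

Definition is_basis (V : lmodType R) N (x : 'I_N -> V) (E : set V) : Prop :=
  linspan x = E /\
  forall c : 'I_N -> R, \sum_n c n *: x n = 0 -> forall n, c n = 0.

Definition norm2 N (c : 'I_N -> R) : R := enorm (\row_n c n).

Definition equivalent_norms (V : Type) (A : set V) (n1 n2 : V -> R) : Prop :=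
  exists a b, [/\ 0 < a, 0 < b &
    forall v, A v -> a * n1 v <= n2 v <= b * n1 v].

Definition dual_norm (X : normedModType R) (w : X -> R) : R :=
  sup [set `|w v| | v in [set v | `|v| <= 1]].

End normed_subspaces.

Section spline_operators.
Variables (R : realType) (d : nat).
Notation S := (schwartz R d).
Notation S' := (tempered R d).

Definition schwartz_to_wL p alpha (F : S -> S') : Prop :=
  (forall phi, wLspace p alpha (F phi)) /\
  (forall phi, wLnorm p alpha (F psi - F phi) @[psi --> phi] --> (0 : R)).

Definition null_space (alpha : R) (Lstar : S -> S') : set S' :=
  [set p | wLspace +oo%E alpha p /\ forall phi, Lpair p (Lstar phi) = 0].

Record spline_admissible (alpha : R) (N0 : nat) (L Lstar : {linear S -> S'})
    (Linv Linvstar : S' -> S') : Prop := SplineAdmissible {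
  sa_adjoint : forall phi psi, L phi psi = Lstar psi phi ;
  sa_L : schwartz_to_wL 1%E (- alpha) L ;
  sa_Lstar : schwartz_to_wL 1%E (- alpha) Lstar ;
  sa_Linv : continuous_operator (wLspace 1%E (- alpha)) (wLnorm 1%E (- alpha))
    (wLspace +oo%E alpha) (wLnorm +oo%E alpha) Linv ;
  sa_Linvstar :
    continuous_operator (wLspace 1%E (- alpha)) (wLnorm 1%E (- alpha))
      (wLspace +oo%E alpha) (wLnorm +oo%E alpha) Linvstar ;
  sa_inv_adjoint : forall f g,
    wLspace 1%E (- alpha) f -> wLspace 1%E (- alpha) g ->
    Lpair (Linv f) g = Lpair f (Linvstar g) ;
  sa_left_inverse_star : forall phi : S,
    density_of (Linvstar (Lstar phi)) phi ;
  sa_left_inverse : forall phi : S, density_of (Linv (L phi)) phi ;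
  sa_null_space : exists p : 'I_N0 -> S',
    is_basis p (null_space alpha Lstar) }.

(* A Schwartz-Banach space is a Banach space [X] with inclusion maps
   [jX : S -> X] and [iX : X -> S'] whose composition is the canonical embedding
   of test functions into distributions.  Continuity and density in [S'] refer
   to the weak-* topology. *)
Record schwartz_banach (X : completeNormedModType R) (jX : {linear S -> X})
    (iX : {linear X -> S'}) : Prop := SchwartzBanach {
  sb_inj : injective iX ;
  sb_embedding : forall phi : S, density_of (iX (jX phi)) phi ;
  sb_continuousS : continuous jX ;
  sb_denseS : dense (range jX) ;
  sb_continuousX : continuous iX ;
  sb_denseX : dense (range iX) }.

Section compatibility.
Variables (X : completeNormedModType R).
Variables (jX : {linear S -> X}) (iX : {linear X -> S'}).
Variables (alpha : R) (N0 : nat) (L Lstar : {linear S -> S'}).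
Variables (Linv Linvstar : S' -> S').
Variable (LstarX : {linear X -> S'}).

(* [(phi0, p0)] is a universal biorthogonal system for which [X]-stability
   holds; [S] sits in [S'] through [iX \o jX]. *)
Record stable_system (phi0 : 'I_N0 -> S) (p0 : 'I_N0 -> S') : Prop :=
  StableSystem {
  ss_basis : is_basis p0 (null_space alpha Lstar) ;
  ss_biorthogonal : forall m n, p0 n (phi0 m) = (m == n)%:R ;
  ss_stable : exists F : S' -> X,
    continuous_operator (wLspace 1%E (- alpha)) (wLnorm 1%E (- alpha))
      setT Num.norm F /\
    forall g, wLspace 1%E (- alpha) g ->
      iX (F g) = Linvstar (g - \sum_n Lpair (p0 n) g *: iX (jX (phi0 n))) }.

(* [LstarX] is the extension of [Lstar] to [X]; it is unique because the range
   of [jX] is dense. *)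
Record compatible : Prop := Compatible {
  compat_space : schwartz_banach jX iX ;
  compat_operator : spline_admissible alpha N0 L Lstar Linv Linvstar ;
  compat_extends : forall phi, LstarX (jX phi) = Lstar phi ;
  compat_continuous : continuous LstarX ;
  compat_injective : injective LstarX ;
  compat_stable : exists phi0 p0, stable_system phi0 p0 }.

End compatibility.

Section native_spaces.
Variables (X : completeNormedModType R).
Variables (jX : {linear S -> X}) (iX : {linear X -> S'}).
Variable (LstarX : {linear X -> S'}).
Variables (N0 : nat) (phi0 : 'I_N0 -> S).

Definition Uspace : set S' := range LstarX.

Definition Uinv (u : S') : X := xget 0 [set v | LstarX v = u].

Let phi0' (n : 'I_N0) : S' := iX (jX (phi0 n)).

(* The sum in U (+) N_phi0 is direct.  This has to be required: for L = d/dx and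
   X the closure of the test functions in the norm sup |f(x)| / (1 + max(x, 0)),
   the sigmoid antiderivative of phi0 lies in X, hence phi0 in U. *)
Definition reference_direct : Prop := Uspace `&` linspan phi0' = [set 0].

Definition predual (phi : 'I_N0 -> S') : set S' :=
  [set g | exists u v, [/\ Uspace u, linspan phi v & g = u + v]].

Definition reference_predual : set S' := predual phi0'.

Definition reference_coord (g : S') : 'I_N0 -> R :=
  xget (fun=> 0) [set c | Uspace (g - \sum_n c n *: phi0' n)].

(* The action of [p] in the null space on the reference pre-dual: it vanishes
   on [Uspace] and is the duality product on the span of [phi0]. *)
Definition pairing (p g : S') : R := \sum_n reference_coord g n * p (phi0 n).

Record biorthogonal_system (alpha : R) (Lstar : S -> S')
    (phi p : 'I_N0 -> S') : Prop := BiorthogonalSystem {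
  bs_basis : is_basis p (null_space alpha Lstar) ;
  bs_predual : forall m, reference_predual (phi m) ;
  bs_biorthogonal : forall m n, pairing (p n) (phi m) = (m == n)%:R }.

Section system.
Variables (phi p : 'I_N0 -> S').

Definition proj_phi (g : S') : S' := \sum_n pairing (p n) g *: phi n.

Definition Linvstar_phi (g : S') : X := Uinv (g - proj_phi g).

Definition p_coord (g : S') : 'I_N0 -> R := fun n => pairing (p n) g.

Definition predual_norm (g : S') : R :=
  Num.max `|Linvstar_phi g| (norm2 (p_coord g)).

Definition predual_norm_sum (g : S') : R :=
  `|Linvstar_phi g| + norm2 (p_coord g).

(* The dual of [predual phi] with norm [predual_norm]; only the values on
   [predual phi] matter.  [native_distributions] is the same space seen in S' by
   restricting functionals to test functions. *)
Definition native : set (S' -> R) :=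
  [set f | continuous_operator (W := R^o)
             (predual phi) predual_norm setT Num.norm f].

Definition native_distributions : set S' :=
  [set T | exists2 f, native f & forall psi, T psi = f (iX (jX psi))].

(* The adjoint L : X_L' -> X' of L* : X -> X_L. *)
Definition adjL (f : S' -> R) : X -> R := f \o LstarX.

Definition phi_coord (f : S' -> R) : 'I_N0 -> R := fun n => f (phi n).

Definition native_norm (f : S' -> R) : R :=
  dual_norm (adjL f) + norm2 (phi_coord f).

Definition proj_p (f : S' -> R) : S' -> R :=
  fun g => \sum_n f (phi n) * pairing (p n) g.

End system.
End native_spaces.
End spline_operators.

(* Main.v *)
(* Write E for the direct sum of U and the span of phi0.  By biorthogonality the
   coordinate matrix of any admissible phi modulo U is invertible, so E is also
   the direct sum of U and the span of phi, and every g in E decomposes as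
     g = L* (L_phi^{-1*} g) + sum_n <p_n, g> phi_n.
   Applying the functionals and operators of the other system to this identity
   gives
     <pt_m, g> = sum_n <p_n, g> <pt_m, phi_n>,
     L_phit^{-1*} g = L_phi^{-1*} g + sum_n <p_n, g> L_phit^{-1*} phi_n,
     f(phit_m) = f(L* L_phi^{-1*} phit_m) + sum_n <p_n, phit_m> f(phi_n),
   and the estimates follow, all constants being finite sums; the opposite
   inequalities are obtained by exchanging the two systems. *)
Require Import Defs.
From mathcomp Require Import all_boot all_order all_algebra.
From mathcomp Require Import all_classical all_reals all_analysis.
From mathcomp Require Import ring.

Set Implicit Arguments.
Unset Strict Implicit.
Unset Printing Implicit Defensive.

Import Order.TTheory GRing.Theory Num.Theory.
Import numFieldNormedType.Exports.

Local Open Scope classical_set_scope.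
Local Open Scope ring_scope.

(* Evaluating the zero distribution at phi gives the integral of phi ^ 2, so phi
   vanishes almost everywhere, which is enough for any T with a density. *)
Lemma density_of0_eval {R : realType} {d : nat} (phi : schwartz R d)
    (T : tempered R d) (f : 'rV[R]_d -> R) :
  density_of 0 phi -> density_of T f -> T phi = 0.
Proof.
move=> [_ /(_ phi) [iphi phi0]] [_ /(_ phi) [ifphi ->]].
pose mu := lebesgue_rV R d.
have mphi2 := measurable_int mu iphi.
have phi2_ae : ae_eq mu setT (fun x => (phi x * phi x)%:E) (cst 0%E).
  apply/(ae_eq_integral_abs mu measurableT mphi2).
  rewrite (_ : (\int[mu]_x `|(phi x * phi x)%:E|)%E =
               (\int[mu]_x (phi x * phi x)%:E)%E).
    rewrite -[LHS]fineK; last exact: integrable_fin_num.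
    by congr EFin; rewrite -[LHS]phi0.
  apply: eq_integral => x _; rewrite gee0_abs // lee_fin -expr2.
  exact: sqr_ge0.
rewrite /Rintegral (ae_eq_integral (cst 0%E)) ?integral_cst ?mul0e //=.
  exact: measurable_int ifphi.
apply: filterS phi2_ae => x /= + _ => /(_ I) -[/eqP].
by rewrite mulf_eq0 orbb => /eqP ->; rewrite mulr0.
Qed.

(** * Euclidean norms of finite families *)

Section norm2.
Context {R : realType}.

Lemma norm2_ge0 N (c : 'I_N -> R) : 0 <= norm2 c.
Proof. exact: sqrtr_ge0. Qed.

Lemma norm2_0 N : norm2 (fun _ : 'I_N => 0 : R) = 0.
Proof.
rewrite /norm2 /enorm big1 ?sqrtr0 // => i _.
by rewrite mxE expr0n.
Qed.

Lemma ler_abs_norm2 N (c : 'I_N -> R) n : `|c n| <= norm2 c.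
Proof.
rewrite -sqrtr_sqr ler_wsqrtr // (bigD1 n) //= mxE lerDl.
by apply: sumr_ge0 => i _; exact: sqr_ge0.
Qed.

Lemma norm2_le_sum N (c : 'I_N -> R) : norm2 c <= \sum_n `|c n|.
Proof.
have s0 : 0 <= \sum_n `|c n| by apply: sumr_ge0.
rewrite -[leRHS]ger0_norm // -sqrtr_sqr ler_wsqrtr // expr2 mulr_suml.
apply: ler_sum => i _; rewrite mxE -normr_id -[leLHS]real_normK ?num_real //.
rewrite normr_id expr2 ler_wpM2l // (bigD1 i) //= lerDl.
exact: sumr_ge0.
Qed.

Lemma norm_lincomb_le (V : normedModType R) N (c : 'I_N -> R) (x : 'I_N -> V) :
  `|\sum_n c n *: x n| <= (\sum_n `|x n|) * norm2 c.
Proof.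
apply: (le_trans (ler_norm_sum _ _ _)); rewrite mulr_suml.
apply: ler_sum => n _; rewrite normrZ mulrC.
by rewrite ler_wpM2l // ler_abs_norm2.
Qed.

Lemma norm2_lincomb_le N M (c : 'I_N -> R) (A : 'I_N -> 'I_M -> R) :
  norm2 (fun m => \sum_n c n * A n m) <= (\sum_m \sum_n `|A n m|) * norm2 c.
Proof.
apply: (le_trans (norm2_le_sum _)); rewrite mulr_suml.
by apply: ler_sum => m _; exact: (@norm_lincomb_le R^o).
Qed.

End norm2.

(** * Norm equivalence and linearity on a subspace *)

(** The lower constant is the inverse of the constant in the reverse estimate, so upper estimates
    alone suffice, one being obtained from the other by exchanging the systems. *)
Lemma equivalent_normsP {R : realType} {V : Type} {A : set V} {n1 n2 : V -> R} :
  (exists2 K, 0 < K & forall v, A v -> n2 v <= K * n1 v) ->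
  (exists2 K, 0 < K & forall v, A v -> n1 v <= K * n2 v) ->
  equivalent_norms A n1 n2.
Proof.
move=> [K K0 n2K] [K' K'0 n1K']; exists K'^-1, K; split => // [|v Av].
  by rewrite invr_gt0.
by rewrite n2K // andbT mulrC ler_pdivrMr // mulrC n1K'.
Qed.

Section linear_on.
Context {R : realType} {V W : lmodType R} {A : set V} {F : V -> W}.
Hypothesis A_lin : forall a u v, A u -> A v -> A (a *: u + v).
Hypothesis F_lin : forall a u v, A u -> A v -> F (a *: u + v) = a *: F u + F v.

(** Coordinates, pairings and functionals are total functions known to be linear only on a subspace
    [A], so membership is carried along. The initial term [u] covers the empty sum. *)
Lemma lincomb_closed N (c : 'I_N -> R) (x : 'I_N -> V) u :
  A u -> (forall n, A (x n)) -> A (u + \sum_n c n *: x n).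
Proof.
move=> Au Ax; rewrite addrC.
elim: (index_enum _) => [|n r IHr]; first by rewrite big_nil add0r.
by rewrite big_cons -addrA; exact: A_lin.
Qed.

Lemma lincomb_map N (c : 'I_N -> R) (x : 'I_N -> V) u :
  A u -> (forall n, A (x n)) ->
  F (u + \sum_n c n *: x n) = F u + \sum_n c n *: F (x n).
Proof.
move=> Au Ax; rewrite addrC [RHS]addrC.
suff [] : A (\sum_n c n *: x n + u) /\
  F (\sum_n c n *: x n + u) = \sum_n c n *: F (x n) + F u by [].
elim: (index_enum _) => [|n r [Ar Fr]]; first by rewrite !big_nil !add0r.
rewrite !big_cons -!addrA; split; first exact: A_lin.
by rewrite F_lin // Fr.
Qed.

Lemma linear_on0 : A 0 -> F 0 = 0.
Proof.
move=> A0; have /eqP := F_lin 1 A0 A0.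
by rewrite scaler0 addr0 scale1r -subr_eq0 opprD addNKr oppr_eq0 => /eqP.
Qed.

End linear_on.

(** * The direct sum of U and the span of the reference test functions *)

Section reference_predual.
Context {R : realType} {d : nat} {X : completeNormedModType R}.
Context {jX : {linear schwartz R d -> X}} {iX : {linear X -> tempered R d}}.
Context {LstarX : {linear X -> tempered R d}} {N0 : nat}.
Context {phi0 : 'I_N0 -> schwartz R d}.

Local Notation e n := (iX (jX (phi0 n))).
Local Notation E := (reference_predual jX iX LstarX phi0).
Local Notation coord := (reference_coord jX iX LstarX phi0).
Local Notation pairing := (pairing jX iX LstarX phi0).
Local Notation pcoord := (p_coord jX iX LstarX phi0).
Local Notation proj := (proj_phi jX iX LstarX phi0).
Local Notation Lphi := (Linvstar_phi jX iX LstarX phi0).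
Local Notation norm_XL := (predual_norm jX iX LstarX phi0).

Hypothesis LstarX_inj : injective LstarX.
Hypothesis phi0_free :
  forall c : 'I_N0 -> R, \sum_n c n *: e n = 0 -> forall n, c n = 0.
Hypothesis phi0_direct : reference_direct jX iX LstarX phi0.

Lemma UinvK v : Uinv LstarX (LstarX v) = v.
Proof. by apply: xget_unique => // w /LstarX_inj. Qed.

(** [reference_coord] is an [xget] choice, so its value rests on uniqueness: two candidates differ
    by a combination in both U and the span of [phi0], which is zero by directness, and freeness
    kills its coefficients. *)
Lemma reference_coordE v c : coord (LstarX v + \sum_n c n *: e n) = c.
Proof.
apply: xget_unique => [|c' [w _ Tw]] /=; first by exists v; rewrite ?addrK.
have diff : \sum_n (c n - c' n) *: e n = LstarX (w - v).
  rewrite linearB Tw addrAC [LstarX v + _]addrC addrK -sumrB.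
  by apply: eq_bigr => n _; rewrite scalerBl.
have : [set 0] (\sum_n (c n - c' n) *: e n).
  rewrite -phi0_direct; split; last by exists (fun n => c n - c' n).
  by rewrite diff; exists (w - v).
move=> /phi0_free c0; apply/funext => n.
by apply/esym/eqP; rewrite -subr_eq0 c0.
Qed.

Lemma reference_predualP g :
  E g <-> exists v, g = LstarX v + \sum_n coord g n *: e n.
Proof.
split=> [[_ [_ [[v _ <-] [c ->] ->]]]|[v ->]].
  by exists v; rewrite reference_coordE.
exists (LstarX v), (\sum_n coord g n *: e n).
by split => //; [exists v|exists (coord g)].
Qed.

Lemma lincomb_reference a v c w c' :
  a *: (LstarX v + \sum_n c n *: e n) + (LstarX w + \sum_n c' n *: e n) =
  LstarX (a *: v + w) + \sum_n (a * c n + c' n) *: e n.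
Proof.
rewrite linearP scalerDr addrACA; congr (_ + _).
rewrite scaler_sumr -big_split; apply: eq_bigr => n _.
by rewrite scalerDl scalerA.
Qed.

Lemma reference_predual_lin a g h : E g -> E h -> E (a *: g + h).
Proof.
move=> /reference_predualP[v ->] /reference_predualP[w ->].
by rewrite lincomb_reference; apply/reference_predualP; exists (a *: v + w);
  rewrite reference_coordE.
Qed.

Lemma reference_coord_lin n a g h :
  E g -> E h -> coord (a *: g + h) n = a * coord g n + coord h n.
Proof.
move=> /reference_predualP[v gE] /reference_predualP[w hE].
by rewrite {1}gE {1}hE lincomb_reference reference_coordE.
Qed.

Lemma reference_coord_U v n : coord (LstarX v) n = 0.
Proof.
rewrite -[LstarX v]addr0 -[X in _ + X](_ : \sum_n 0 *: e n = 0).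
  by rewrite reference_coordE.
by rewrite big1 // => m _; rewrite scale0r.
Qed.

Lemma reference_predual_U v : E (LstarX v).
Proof.
apply/reference_predualP; exists v.
by rewrite big1 ?addr0 // => n _; rewrite reference_coord_U scale0r.
Qed.

Lemma pairing_lin q a g h :
  E g -> E h -> pairing q (a *: g + h) = a * pairing q g + pairing q h.
Proof.
move=> Eg Eh; rewrite /Defs.pairing mulr_sumr -big_split.
by apply: eq_bigr => n _; rewrite reference_coord_lin // mulrDl mulrA.
Qed.

Lemma pairing_U q v : pairing q (LstarX v) = 0.
Proof.
by rewrite /Defs.pairing big1 // => n _; rewrite reference_coord_U mul0r.
Qed.

(** * Decomposition along one biorthogonal system *)

Section system.
Context {alpha : R} {Lstar : schwartz R d -> tempered R d}.
Context {phi p : 'I_N0 -> tempered R d}.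
Hypothesis hphi : biorthogonal_system jX iX LstarX phi0 alpha Lstar phi p.

Let phiE m : E (phi m). Proof. exact: (bs_predual hphi). Qed.

(* Biorthogonality says C M = 1 for C m k := coord (phi m) k and
   M k n := p n (phi0 k); for square matrices this gives M C = 1. *)
Lemma sum_p_coord g k : \sum_n pcoord p g n * coord (phi n) k = coord g k.
Proof.
pose C := \matrix_(m, l) coord (phi m) l.
pose M := \matrix_(l, n) p n (phi0 l).
have CM : C *m M = 1%:M.
  apply/matrixP => m n; rewrite !mxE -(bs_biorthogonal hphi).
  by apply: eq_bigr => l _; rewrite !mxE.
have /matrixP/(_ ord0 k) : (\row_l coord g l) *m (M *m C) = \row_l coord g l.
  by rewrite (mulmx1C CM) mulmx1.
rewrite mulmxA !mxE => <-; apply: eq_bigr => n _; rewrite !mxE; congr (_ * _).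
by apply: eq_bigr => l _; rewrite !mxE.
Qed.

(** By [sum_p_coord], g minus its projection has zero reference coordinates, hence lies in U, where
    [Uinv] recovers its preimage. *)
Lemma predual_decomposition g :
  E g -> g = LstarX (Lphi phi p g) + \sum_n pcoord p g n *: phi n.
Proof.
move=> Eg.
have projN : g - proj phi p g = g + \sum_n - pcoord p g n *: phi n.
  by congr (_ + _); rewrite -sumrN; apply: eq_bigr => n _; rewrite scaleNr.
have /reference_predualP[v] : E (g - proj phi p g).
  by rewrite projN; exact: (lincomb_closed reference_predual_lin).
rewrite big1 ?addr0 => [gv|n _].
  by rewrite /Linvstar_phi gv UinvK -gv /proj_phi subrK.
rewrite projN (@lincomb_map _ _ R^o E (coord ^~ n)) //=.
- rewrite [X in _ + X](_ : _ = - coord g n) ?subrr ?scale0r // -sum_p_coord -sumrN.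
  by apply: eq_bigr => m _; rewrite /GRing.scale /= mulNr.
- exact: reference_predual_lin.
- exact: reference_coord_lin.
Qed.

(** One inclusion is closure of E under combinations, the other the decomposition. Since E involves
    only [phi0], two systems have the same pre-dual set. *)
Lemma predualE : predual LstarX phi = E.
Proof.
apply/seteqP; split=> [_ [_ [_ [[v _ <-] [c ->] ->]]]|g Eg].
  apply: (lincomb_closed reference_predual_lin) => //.
  exact: reference_predual_U.
exists (LstarX (Lphi phi p g)), (\sum_n pcoord p g n *: phi n).
split; [by exists (Lphi phi p g)|by exists (pcoord p g)|].
exact: predual_decomposition.
Qed.

Lemma proj_phi_U v : proj phi p (LstarX v) = 0.
Proof. by rewrite /proj_phi big1 // => n _; rewrite pairing_U scale0r. Qed.

Lemma Linvstar_phi_U v : Lphi phi p (LstarX v) = v.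
Proof. by rewrite /Linvstar_phi proj_phi_U subr0 UinvK. Qed.

(** Pairings vanish on U, so only the first entry of the maximum survives: [LstarX] is an isometry
    into the pre-dual. *)
Lemma predual_norm_U v : norm_XL phi p (LstarX v) = `|v|.
Proof.
rewrite /predual_norm Linvstar_phi_U (_ : p_coord _ _ _ _ _ _ = fun=> 0).
  by rewrite norm2_0 max_l.
by apply/funext => n; exact: pairing_U.
Qed.

Lemma predual_norm_le_sum g :
  norm_XL phi p g <= predual_norm_sum jX iX LstarX phi0 phi p g.
Proof. by rewrite ge_max lerDl lerDr norm2_ge0 normr_ge0. Qed.

(** Linearity comes from the decomposition: after applying the injective [LstarX] and adding back
    the [phi] part, both sides equal [a *: g + h]. *)
Lemma Linvstar_phi_lin a g h :
  E g -> E h -> Lphi phi p (a *: g + h) = a *: Lphi phi p g + Lphi phi p h.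
Proof.
move=> Eg Eh; apply: LstarX_inj.
have Egh := reference_predual_lin a Eg Eh.
apply: (@addIr _ (\sum_n pcoord p (a *: g + h) n *: phi n)).
rewrite -predual_decomposition // linearP.
rewrite {1}(predual_decomposition Eg) {1}(predual_decomposition Eh).
rewrite scalerDr addrACA; congr (_ + _).
rewrite scaler_sumr -big_split; apply: eq_bigr => n _ /=.
by rewrite /p_coord pairing_lin // scalerDl scalerA.
Qed.

(** The projection vanishes on U, which leaves the adjoint part unchanged, and agrees with f on
    every [phi m], which removes the coordinate part. *)
Lemma native_norm_subr_proj_p (f : tempered R d -> R) :
  native_norm LstarX phi (f - proj_p jX iX LstarX phi0 phi p f) =
  dual_norm (adjL LstarX f).
Proof.
rewrite /native_norm (_ : adjL _ (f - _) = adjL LstarX f); last first.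
  apply/funext => v.
  rewrite -[LHS]/(f (LstarX v) - proj_p jX iX LstarX phi0 phi p f (LstarX v)).
  by rewrite /proj_p big1 ?subr0 // => n _; rewrite pairing_U mulr0.
rewrite (_ : phi_coord _ _ = fun=> 0) ?norm2_0 ?addr0 //.
apply/funext => m.
rewrite -[LHS]/(f (phi m) - proj_p jX iX LstarX phi0 phi p f (phi m)) /proj_p.
rewrite (bigD1 m) //= (bs_biorthogonal hphi) eqxx mulr1 big1 ?addr0 ?subrr //.
by move=> n nm; rewrite (bs_biorthogonal hphi) eq_sym (negbTE nm) mulr0.
Qed.

(** * Continuous functionals on the pre-dual *)

Section native.
Context {f : tempered R d -> R}.
Hypothesis hf : native jX iX LstarX phi0 phi p f.

Lemma native_lin a g h : E g -> E h -> f (a *: g + h) = a * f g + f h.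
Proof. by rewrite -predualE; exact: (co_linear hf). Qed.

Lemma native0 : f 0 = 0.
Proof.
apply: (@linear_on0 _ _ R^o E); first exact: native_lin.
by rewrite -(linear0 LstarX); exact: reference_predual_U.
Qed.

Lemma nativeZ a v : f (LstarX (a *: v)) = a * f (LstarX v).
Proof.
have E0 : E 0 by rewrite -(linear0 LstarX); exact: reference_predual_U.
have := native_lin a (reference_predual_U v) E0.
by rewrite native0 !addr0 linearZ.
Qed.

(** [sup] is an upper bound only for sets that are bounded above. Continuity at 0 with tolerance 1
    gives a radius r, and rescaling the unit ball bounds the values by 2 / r. *)
Lemma dual_norm_ubound : has_ubound
  [set `|adjL LstarX f v| | v in [set v : X | `|v| <= 1]].
Proof.
have P0 : predual LstarX phi 0.
  by rewrite predualE -(linear0 LstarX); exact: reference_predual_U.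
have [r r0 fr] := co_continuous hf P0 ltr01.
(* Half the radius, since v runs over the closed ball while continuity asks for a strict
   inequality. *)
have r2 : 0 < r / 2 by rewrite divr_gt0.
exists (r / 2)^-1 => _ [v /= v1 <-]; rewrite -[leRHS]mul1r ler_pdivlMr //.
have rv : `|(r / 2) *: v| < r.
  rewrite normrZ gtr0_norm // (le_lt_trans (ler_piMr (ltW r2) v1)) //.
  by rewrite ltr_pdivrMr // ltr_pMr // ltr1n.
have := fr (LstarX ((r / 2) *: v)).
rewrite subr0 predual_norm_U native0 subr0 nativeZ normrM gtr0_norm //.
rewrite [in X in _ -> _ -> X]mulrC => frv; apply/ltW/frv => //.
by rewrite predualE; exact: reference_predual_U.
Qed.

Lemma dual_norm_ge0 : 0 <= dual_norm (adjL LstarX f).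
Proof.
apply: (le_trans (normr_ge0 (f (LstarX 0)))).
by apply: (ub_le_sup dual_norm_ubound); exists 0; rewrite //= normr0.
Qed.

Lemma ler_dual_norm v : `|f (LstarX v)| <= dual_norm (adjL LstarX f) * `|v|.
Proof.
have [->|v0] := eqVneq v 0.
  by rewrite linear0 native0 !normr0 mulr0.
have nv0 : 0 < `|v| by rewrite normr_gt0.
rewrite -ler_pdivrMr // mulrC -[X in X * _]gtr0_norm ?invr_gt0 //.
rewrite -normrM -nativeZ; apply: (ub_le_sup dual_norm_ubound).
exists (`|v|^-1 *: v) => //=.
by rewrite normrZ normfV normr_id mulVf // gt_eqF.
Qed.

Lemma native_decomposition g : E g ->
  f g = f (LstarX (Lphi phi p g)) + \sum_n pcoord p g n * f (phi n).
Proof.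
move=> Eg; rewrite {1}(predual_decomposition Eg).
rewrite (@lincomb_map _ _ R^o E f) //.
- exact: reference_predual_lin.
- exact: native_lin.
- exact: reference_predual_U.
Qed.

End native.
End system.

(** * Change of biorthogonal system *)

Section two_systems.
Context {alpha : R} {Lstar : schwartz R d -> tempered R d}.
Context {phi p phit pt : 'I_N0 -> tempered R d}.
Hypothesis hphi : biorthogonal_system jX iX LstarX phi0 alpha Lstar phi p.
Hypothesis hphit : biorthogonal_system jX iX LstarX phi0 alpha Lstar phit pt.

(** The U part of g pairs to zero. For q = [pt m] this is a change of coordinates with matrix
    [pairing (pt m) (phi n)]. *)
Lemma pairing_change q g : E g ->
  pairing q g = \sum_n pcoord p g n * pairing q (phi n).
Proof.
move=> Eg; rewrite {1}(predual_decomposition hphi Eg).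
rewrite (@lincomb_map _ _ R^o E (pairing q)) ?pairing_U ?add0r //.
- exact: reference_predual_lin.
- exact: pairing_lin.
- exact: reference_predual_U.
- exact: (bs_predual hphi).
Qed.

Lemma norm2_p_coord_le : exists2 K, 0 < K &
  forall g, E g -> norm2 (pcoord pt g) <= K * norm2 (pcoord p g).
Proof.
(* The summand 1 keeps the constant positive even when the matrix has no entries. *)
exists (1 + \sum_m \sum_n `|pairing (pt m) (phi n)|) => [|g Eg].
  by rewrite ltr_wpDr // sumr_ge0 // => m _; exact: sumr_ge0.
rewrite (_ : pcoord pt g =
    fun m => \sum_n pcoord p g n * pairing (pt m) (phi n)).
  apply: (le_trans (norm2_lincomb_le _ _)).
  by rewrite ler_wpM2r ?norm2_ge0 // lerDr.
by apply/funext => m; exact: pairing_change.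
Qed.

Lemma norm2_phi_coord_pairing_le : exists2 K, 0 < K &
  forall q, norm2 (phi_coord phit (pairing q)) <=
    K * norm2 (phi_coord phi (pairing q)).
Proof.
exists (1 + \sum_m \sum_n `|pcoord p (phit m) n|) => [|q].
  by rewrite ltr_wpDr // sumr_ge0 // => m _; exact: sumr_ge0.
rewrite (_ : phi_coord phit (pairing q) =
    fun m => \sum_n phi_coord phi (pairing q) n * pcoord p (phit m) n).
  apply: (le_trans (norm2_lincomb_le _ _)).
  by rewrite ler_wpM2r ?norm2_ge0 // lerDr.
apply/funext => m.
rewrite /phi_coord pairing_change; last exact: (bs_predual hphit).
by apply: eq_bigr => n _; rewrite mulrC.
Qed.

(** On U both operators undo [LstarX] and agree, so they can differ only through the finitely many
    [phi n]. *)
Lemma Linvstar_phi_change g : E g ->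
  Lphi phit pt g = Lphi phi p g + \sum_n pcoord p g n *: Lphi phit pt (phi n).
Proof.
move=> Eg; rewrite {1}(predual_decomposition hphi Eg).
rewrite (lincomb_map reference_predual_lin (Linvstar_phi_lin hphit)).
- by rewrite Linvstar_phi_U.
- exact: reference_predual_U.
- exact: (bs_predual hphi).
Qed.

Lemma predual_norm_sum_le : exists2 K, 0 < K & forall g, E g ->
  predual_norm_sum jX iX LstarX phi0 phit pt g <= K * norm_XL phi p g.
Proof.
have [K K0 pK] := norm2_p_coord_le.
set S := \sum_n `|Lphi phit pt (phi n)|.
have S0 : 0 <= S by exact: sumr_ge0.
(* 1 comes from [Lphi phi p g], S from the correction in [Linvstar_phi_change], K from the
   coordinates. *)
exists (1 + S + K) => [|g Eg]; first by rewrite addr_gt0 // ltr_wpDr.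
have pm : norm2 (pcoord p g) <= norm_XL phi p g by rewrite le_max lexx orbT.
rewrite /predual_norm_sum mulrDl; apply: lerD; last first.
  by apply: (le_trans (pK _ Eg)); rewrite ler_wpM2l // ltW.
rewrite Linvstar_phi_change // (le_trans (ler_normD _ _)) // mulrDl mul1r.
apply: lerD; first by rewrite le_max lexx.
by apply: (le_trans (norm_lincomb_le _ _)); rewrite ler_wpM2l.
Qed.

(** The dual norm of [adjL LstarX f] occurs in both norms, so only the values of f at [phit m] need
    a bound. Each splits into a value on U, bounded by the dual norm, and a combination of the
    values at [phi n]. *)
Lemma native_norm_le : exists2 K, 0 < K &
  forall f, native jX iX LstarX phi0 phi p f ->
    native_norm LstarX phit f <= K * native_norm LstarX phi f.
Proof.
set S := \sum_m `|Lphi phi p (phit m)|.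
set A := \sum_m \sum_n `|pcoord p (phit m) n|.
have S0 : 0 <= S by exact: sumr_ge0.
have A0 : 0 <= A by apply: sumr_ge0 => m _; exact: sumr_ge0.
exists (1 + S + A) => [|f hf]; first by rewrite -addrA ltr_wpDr // addr_ge0.
have D0 := dual_norm_ge0 hphi hf.
have phi_ge0 := norm2_ge0 (phi_coord phi f).
suff : norm2 (phi_coord phit f) <=
    S * dual_norm (adjL LstarX f) + A * norm2 (phi_coord phi f).
  rewrite /native_norm; set D := dual_norm _ in D0 *.
  move: (norm2 (phi_coord phi f)) phi_ge0 => b b0.
  move=> le_t; apply: (@le_trans _ _ (D + (S * D + A * b))).
    by rewrite lerD2l.
  (* These terms are what (1 + S + A) * (D + b) leaves after D + S * D + A * b is removed. *)
  rewrite -subr_ge0 (_ : _ - _ = b + S * b + A * D); last by ring.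
  by rewrite !addr_ge0 // mulr_ge0.
apply: (le_trans (norm2_le_sum _)).
rewrite /S /A !mulr_suml -big_split; apply: ler_sum => m _.
rewrite /phi_coord (native_decomposition hphi hf); last exact: (bs_predual hphit).
apply: (le_trans (ler_normD _ _)); apply: lerD.
  by rewrite mulrC; exact: (ler_dual_norm hphi hf).
(* The values of f become the coefficients and the coordinates of [phit m] the vectors, so that the
   factor is [norm2 (phi_coord phi f)]. *)
rewrite (eq_bigr (fun n => f (phi n) *: (pcoord p (phit m) n : R^o))).
  exact: (@norm_lincomb_le _ R^o).
by move=> n _; rewrite mulrC.
Qed.

Lemma predual_norm_le : exists2 K, 0 < K &
  forall g, E g -> norm_XL phit pt g <= K * norm_XL phi p g.
Proof.
have [K K0 sK] := predual_norm_sum_le.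
by exists K => // g /sK; apply: le_trans; exact: predual_norm_le_sum.
Qed.

(** Both kinds of functionals live on E, and a radius r for the [phit] norm becomes r / K for the
    [phi] norm. *)
Lemma native_subset :
  native jX iX LstarX phi0 phit pt `<=` native jX iX LstarX phi0 phi p.
Proof.
move=> f [f_lin _ f_cont].
have [K K0 nK] := predual_norm_le.
split => //; rewrite (predualE hphi) -(predualE hphit) // => u Eu eps eps0.
have [r r0 fr] := f_cont u Eu eps eps0.
exists (r / K) => [|v Ev uv]; first exact: divr_gt0.
apply: fr => //; rewrite (le_lt_trans (nK _ _)) -?ltr_pdivlMl // 1?mulrC //.
rewrite addrC -scaleN1r.
by apply: reference_predual_lin; rewrite -(predualE hphit).
Qed.

End two_systems.
End reference_predual.

(** * Independence of the test functions and the final assembly *)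

(** A linear relation makes the combination of the [phi0 m] a density of the zero distribution.
    Having a density itself, [p0 n] vanishes there, while biorthogonality gives the value [c n]. *)
Lemma test_functions_free (R : realType) (d : nat)
    (X : completeNormedModType R)
    (jX : {linear schwartz R d -> X}) (iX : {linear X -> tempered R d})
    (N0 : nat) (phi0 : 'I_N0 -> schwartz R d) (p0 : 'I_N0 -> tempered R d) :
  (forall phi, density_of (iX (jX phi)) phi) ->
  (forall n, exists f, density_of (p0 n) f) ->
  (forall m n, p0 n (phi0 m) = (m == n)%:R) ->
  forall c : 'I_N0 -> R, \sum_n c n *: iX (jX (phi0 n)) = 0 ->
  forall n, c n = 0.
Proof.
move=> embed p0_density biorth c c0 n; have [f p0f] := p0_density n.
have sum0 : iX (jX (\sum_m c m *: phi0 m)) = 0.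
  by rewrite !linear_sum -[RHS]c0; apply: eq_bigr => m _; rewrite !linearZ.
have := embed (\sum_m c m *: phi0 m); rewrite sum0 => /density_of0_eval/(_ p0f).
suff -> : p0 n (\sum_m c m *: phi0 m) = c n by [].
have /set_mem[p0_lin _] := valP (p0 n).
have p0_linT a u v : setT u -> setT v -> p0 n (a *: u + v) = a * p0 n u + p0 n v.
  by move=> _ _; exact: p0_lin.
have p00 : p0 n 0 = 0 by exact: (@linear_on0 _ _ R^o setT).
rewrite -[\sum_m _]add0r.
have -> : p0 n (0 + \sum_m c m *: phi0 m) = p0 n 0 + \sum_m c m * p0 n (phi0 m).
  by rewrite (@lincomb_map _ _ R^o setT).
rewrite p00 add0r (bigD1 n) //= biorth eqxx mulr1 big1 ?addr0 // => m mn.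
by rewrite biorth (negbTE mn) mulr0.
Qed.

Theorem theorem5 (R : realType) (d : nat)
    (X : completeNormedModType R)
    (jX : {linear schwartz R d -> X}) (iX : {linear X -> tempered R d})
    (alpha : R) (N0 : nat)
    (L Lstar : {linear schwartz R d -> tempered R d})
    (Linv Linvstar : tempered R d -> tempered R d)
    (LstarX : {linear X -> tempered R d})
    (hcompat : compatible jX iX alpha N0 L Lstar Linv Linvstar LstarX)
    (phi0 : 'I_N0 -> schwartz R d) (p0 : 'I_N0 -> tempered R d)
    (hstable : stable_system jX iX alpha Lstar Linvstar phi0 p0)
    (hdirect : reference_direct jX iX LstarX phi0)
    (phi p phit pt : 'I_N0 -> tempered R d)
    (hphi : biorthogonal_system jX iX LstarX phi0 alpha Lstar phi p)
    (hphit : biorthogonal_system jX iX LstarX phi0 alpha Lstar phit pt) :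
  let XL := predual LstarX phi in
  let XLt := predual LstarX phit in
  let XL' := native jX iX LstarX phi0 phi p in
  let XLt' := native jX iX LstarX phi0 phit pt in
  let nXL := predual_norm jX iX LstarX phi0 phi p in
  let nXLt := predual_norm jX iX LstarX phi0 phit pt in
  let sXLt := predual_norm_sum jX iX LstarX phi0 phit pt in
  let nXL' := native_norm LstarX phi in
  let nXLt' := native_norm LstarX phit in
  let act := pairing jX iX LstarX phi0 in
  [/\ XL = XLt,
      XL' = XLt' /\
      native_distributions jX iX LstarX phi0 phi p =
        native_distributions jX iX LstarX phi0 phit pt,
      equivalent_norms XL nXL nXLt &
      equivalent_norms XL' nXL' nXLt'] /\
  exists A1 A2 B1 B2 A1' A2' B1' B2' : R,
    ([/\ 0 < A1, 0 < A2, 0 < B1 & 0 < B2] /\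
     [/\ 0 < A1', 0 < A2', 0 < B1' & 0 < B2']) /\
    [/\ forall f, XL' f ->
          dual_norm (adjL LstarX f) =
          nXLt' (f - proj_p jX iX LstarX phi0 phit pt f),
        forall f, XL' f -> A1 * nXL' f <= nXLt' f <= A2 * nXL' f &
        forall q, null_space alpha Lstar q ->
          B1 * norm2 (phi_coord phi (act q))
            <= norm2 (phi_coord phit (act q))
            <= B2 * norm2 (phi_coord phi (act q))] /\
    [/\ forall u, Uspace LstarX u ->
          `|Linvstar_phi jX iX LstarX phi0 phit pt u| =
            nXL (u - proj_phi jX iX LstarX phi0 phit pt u) /\
          nXL (u - proj_phi jX iX LstarX phi0 phit pt u) = `|Uinv LstarX u|,
        forall g, XL g -> A1' * nXL g <= sXLt g <= A2' * nXL g &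
        forall g, XL g ->
          B1' * norm2 (p_coord jX iX LstarX phi0 p g)
            <= norm2 (p_coord jX iX LstarX phi0 pt g)
            <= B2' * norm2 (p_coord jX iX LstarX phi0 p g)].
Proof.
move=> XL XLt XL' XLt' nXL nXLt sXLt nXL' nXLt' act.
have [hspace _ _ _ T_inj _] := hcompat.
have free := test_functions_free (sb_embedding hspace) _ (ss_biorthogonal hstable).
have {}free : forall c : 'I_N0 -> R,
    \sum_n c n *: iX (jX (phi0 n)) = 0 -> forall n, c n = 0.
  apply: free => n; have [p0E _] := ss_basis hstable.
  have : null_space alpha Lstar (p0 n).
    rewrite -p0E; exists (fun m => (m == n)%:R).
    rewrite (bigD1 n) //= eqxx scale1r big1 ?addr0 // => m /negbTE ->.
    by rewrite scale0r.
  by case=> -[].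
have XLE : XL = reference_predual jX iX LstarX phi0.
  exact: (predualE T_inj free hdirect hphi).
have XLtE : XLt = reference_predual jX iX LstarX phi0.
  exact: (predualE T_inj free hdirect hphit).
have nativeE : XL' = XLt'.
  apply/seteqP; split; first exact: (native_subset T_inj free hdirect hphit hphi).
  exact: (native_subset T_inj free hdirect hphi hphit).
have predual_equiv : equivalent_norms XL nXL nXLt.
  by rewrite XLE; apply: equivalent_normsP; apply: predual_norm_le; eassumption.
have native_equiv : equivalent_norms XL' nXL' nXLt'.
  apply: equivalent_normsP; first by apply: native_norm_le; eassumption.
  by rewrite nativeE; apply: native_norm_le; eassumption.
split.
  split=> //; first by rewrite XLE XLtE.
  by split=> //; rewrite /native_distributions -/XL' -/XLt' nativeE.
have [A1 [A2 [A10 A20 nativeA]]] := native_equiv.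
have [B1 [B2 [B10 B20 phiB]]] : equivalent_norms (null_space alpha Lstar)
    (fun q => norm2 (phi_coord phi (act q)))
    (fun q => norm2 (phi_coord phit (act q))).
  apply: equivalent_normsP.
    have [K K0 le_K] := norm2_phi_coord_pairing_le T_inj free hdirect hphi hphit.
    by exists K.
  have [K K0 le_K] := norm2_phi_coord_pairing_le T_inj free hdirect hphit hphi.
  by exists K.
have [A1' [A2' [A1'0 A2'0 predualA]]] : equivalent_norms XL nXL sXLt.
  apply: equivalent_normsP; rewrite XLE.
    by apply: predual_norm_sum_le; eassumption.
  (* Conversely, the maximum norm for [phit] is bounded by the sum norm. *)
  have [K K0 le_K] := predual_norm_le T_inj free hdirect hphit hphi.
  exists K => // g /le_K /le_trans; apply.
  by rewrite (ler_wpM2l (ltW K0)) //; exact: predual_norm_le_sum.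
have [B1' [B2' [B1'0 B2'0 pB]]] : equivalent_norms XL
    (fun g => norm2 (p_coord jX iX LstarX phi0 p g))
    (fun g => norm2 (p_coord jX iX LstarX phi0 pt g)).
  by rewrite XLE; apply: equivalent_normsP; apply: norm2_p_coord_le; eassumption.
exists A1, A2, B1, B2, A1', A2', B1', B2'; split=> //; split; split=> //.
  by move=> f _; rewrite /nXLt' (native_norm_subr_proj_p free hdirect hphit).
(* For u = L* v the projection is zero and all three quantities equal the norm of v. *)
move=> _ [v _ <-].
rewrite (proj_phi_U free hdirect) subr0.
rewrite /nXL (predual_norm_U T_inj free hdirect).
by rewrite (Linvstar_phi_U T_inj free hdirect) (UinvK T_inj).
Qed.
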